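(* Let $(P,\gamma)$ be a labelled poset with ground set $X$, $|X|=n$, and let $\sigma:X\to[n]$ be a bijection. Then: (1) $\Theta_{\mathrm{NCQSym}}(\mathbf F_{(A,\sigma)})=\mathbf K_{(A\setminus((A+1)\cup\{1\}),\sigma)}$ for all $A\subseteq[n-1]$ and $\sigma\in\mathfrak S_n$ (with $(A,\sigma)$ not necessarily standard); (2) $\Theta_{\mathrm{NCQSym}}(\mathbf F_{(P,\gamma,\sigma)})=\mathbf K_{(P,\gamma,\sigma)}$; (3) $\rho\circ\Theta_{\mathrm{NCQSym}}=\Theta_{\mathrm{QSym}}\circ\rho$ as maps $\mathrm{NCQSym}\to\Pi$.
   Context: Let $\mathbf x_1,\mathbf x_2,\dots$ be noncommuting and $x_1,x_2,\dots$ commuting variables over $\mathbb Q$; $[m]=\{1,\dots,m\}$; $A+1=\{a+1:a\in A\}$. A labelled poset $(P,\gamma)$ is a poset $P$ on an $n$-set $X$ with a bijection $\gamma:X\to[n]$. A $(P,\gamma)$-partition is $f:X\to\{1,2,\dots\}$ with $f(a)\le f(b)$ whenever $a\le b$, and $f(a)<f(b)$ whenever $a\le b$ and $\gamma(a)>\gamma(b)$. Order nonzero integers by $-1\prec1\prec-2\prec2\prec\cdots$; an enriched $(P,\gamma)$-partition is $f:X\to\mathbb Z\setminus\{0\}$ such that for $a\le b$: $f(a)\preceq f(b)$, $f(a)=f(b)>0\Rightarrow\gamma(a)<\gamma(b)$, $f(a)=f(b)<0\Rightarrow\gamma(a)>\gamma(b)$. For a bijection $\sigma:X\to[n]$: $\mathbf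 F_{(P,\gamma,\sigma)}=\sum_f\mathbf x_{f(\sigma^{-1}(1))}\cdots\mathbf x_{f(\sigma^{-1}(n))}$ over $(P,\gamma)$-partitions, and $\mathbf K_{(P,\gamma,\sigma)}=\sum_f\mathbf x_{|f(\sigma^{-1}(1))|}\cdots\mathbf x_{|f(\sigma^{-1}(n))|}$ over enriched $(P,\gamma)$-partitions; $F_{(P,\gamma)},K_{(P,\gamma)}$ are the same sums in commuting variables $\prod_{a\in X}x_{f(a)}$, resp. $\prod_a x_{|f(a)|}$. For $A\subseteq[n-1]$, $\sigma\in\mathfrak S_n$: $\mathbf F_{(A,\sigma)}=\mathbf F_{(P,\gamma,\sigma)}$ with $P$ the chain $1<\cdots<n$ and any $\gamma\in\mathfrak S_n$ with $\mathrm{Des}(\gamma)=\{i:\gamma(i)>\gamma(i+1)\}=A$ (this depends only on $A,\sigma$); similarly, for a peak set $B$ (a subset of $\{2,\dots,n-1\}$ with no two consecutive integers), $\mathbf K_{(B,\sigma)}=\mathbf K_{(P,\gamma,\sigma)}$ for the chain and any $\gamma$ with $\mathrm{Peak}(\gamma)=\{i:\gamma(i-1)<\gamma(i)>\gamma(i+1)\}=B$ (well defined). $F_A$, $K_B$ are the commutative analogues. $(A,\sigma)$ is standard if $\mathrm{Des}(\sigma)\subseteq A$. $\mathrm{NCQSym}$ is the $\mathbb Q$-span of all $\mathbf F_{(A,\sigma)}$ (the standard ones form a basis); $\mathrm{NC}\Pi$ is the span of all $\mathbf K_{(P,\gamma,\sigma)}$; $\mathrm{QSym}$ is the span of all $F_A$;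 $\Pi$ is the span of all $K_{(P,\gamma)}$ (equivalently of all $K_B$). $\Theta_{\mathrm{NCQSym}}:\mathrm{NCQSym}\to\mathrm{NC}\Pi$ is the linear map with $\mathbf F_{(A,\sigma)}\mapsto\mathbf K_{(A\setminus((A+1)\cup\{1\}),\sigma)}$ for standard $(A,\sigma)$. $\Theta_{\mathrm{QSym}}:\mathrm{QSym}\to\Pi$ is the linear map $F_A\mapsto K_{A\setminus((A+1)\cup\{1\})}$. $\rho$ denotes the map making the variables commute, $\mathbf x_i\mapsto x_i$. *)

(* Defs.v *)
From HB Require Import structures.
From mathcomp Require Import all_boot all_order all_algebra all_fingroup.
From mathcomp Require Import finmap multiset.
From mathcomp Require Import boolp classical_sets functions cardinality fsbigop.

Set Implicit Arguments.
Unset Strict Implicit.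
Unset Printing Implicit Defensive.

Import Order.TTheory GRing.Theory Num.Theory.
Local Open Scope mset_scope.
Local Open Scope ring_scope.

(* Throughout, [m] = {1, ..., m} is encoded by 'I_m, the ordinal i standing   *)
(* for the integer i + 1; in particular subsets of [n-1] are {set 'I_n.-1}.   *)

Record bijection (X : finType) (n : nat) := Bijection {
  bij_fun :> X -> 'I_n;
  bij_inv : 'I_n -> X;
  bij_funK : cancel bij_fun bij_inv;
  bij_invK : cancel bij_inv bij_fun }.

Definition perm_bij n (s : 'S_n) : bijection 'I_n n :=
  Bijection (permK s) (permKV s).

(* The poset P is the order of X; gamma is the labelling. *)
Definition is_partition d (X : finPOrderType d) n (gamma : bijection X n)
    (f : X -> nat) : Prop :=
  [/\ forall a, (0 < f a)%N,
      forall a b, (a <= b)%O -> (f a <= f b)%N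
    & forall a b, (a <= b)%O -> (gamma b < gamma a)%N -> (f a < f b)%N].

(* -1 < 1 < -2 < 2 < ... *)
Definition enriched_le (x y : int) : bool :=
  (`|x| < `|y|)%N || ((`|x| == `|y|)%N && (x <= y)).

(* The condition concerns pairs a < b only: for a = b its last two clauses    *)
(* would require gamma a < gamma a.                                           *)
Definition is_enriched_partition d (X : finPOrderType d) n
    (gamma : bijection X n) (f : X -> int) : Prop :=
  (forall a, f a != 0) /\
  (forall a b, (a < b)%O ->
    [/\ enriched_le (f a) (f b),
        f a = f b -> 0 < f a -> (gamma a < gamma b)%N
      & f a = f b -> f a < 0 -> (gamma b < gamma a)%N]).

(* A series is its coefficient function: on words in the indices of the       *)
(* variables for noncommuting variables, on multisets of indices for          *)
(* commuting ones. The variables are x_1, x_2, ...; the index 0 never occurs. *)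
Definition ncseries := seq nat -> rat^o.
Definition cseries := {mset nat} -> rat^o.
HB.instance Definition _ := GRing.Lmodule.copy ncseries (seq nat -> rat^o).
HB.instance Definition _ := GRing.Lmodule.copy cseries ({mset nat} -> rat^o).

(* The sum of the monomials mon f, f in S: every monomial below arises from   *)
(* finitely many f, so that each coefficient is a finite sum.                 *)
Definition monomial_sum (M I : choiceType) (S : set I) (mon : I -> M) :
    M -> rat^o :=
  fun m => \sum_(f \in S) ((mon f == m)%:R : rat).

Definition word (X : finType) n (sigma : bijection X n) (g : X -> nat) :
    seq nat :=
  [seq g (bij_inv sigma i) | i <- enum 'I_n].

Definition content (X : finType) (g : X -> nat) : {mset nat} :=
  seq_mset [seq g a | a <- enum X].

Section GeneratingFunctions.
Variables (d : Order.disp_t) (X : finPOrderType d) (n : nat).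
Variables (gamma sigma : bijection X n).

Definition ncF : ncseries :=
  monomial_sum [set f : {ffun X -> nat} | is_partition gamma f]%classic
               (fun f => word sigma f).

Definition ncK : ncseries :=
  monomial_sum [set f : {ffun X -> int} | is_enriched_partition gamma f]%classic
               (fun f => word sigma (fun a => `|f a|%N)).

Definition cF : cseries :=
  monomial_sum [set f : {ffun X -> nat} | is_partition gamma f]%classic
               (fun f => content f).

Definition cK : cseries :=
  monomial_sum [set f : {ffun X -> int} | is_enriched_partition gamma f]%classic
               (fun f => content (fun a => `|f a|%N)).

End GeneratingFunctions.

(* Each commutative monomial m is the image of the words in [permutations m]. *)
Definition rho (p : ncseries) : cseries :=
  fun m => \sum_(w <- permutations (m : seq nat)) p w.

Lemma hi_subproof n (i : 'I_n.-1) : (i.+1 < n)%N.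
Proof. by rewrite -ltn_predRL. Qed.

(* The elements i and i + 1 of [n], for i in [n-1]. *)
Definition lo n (i : 'I_n.-1) : 'I_n := widen_ord (leq_pred n) i.
Definition hi n (i : 'I_n.-1) : 'I_n := Ordinal (hi_subproof i).

Definition Des n (gamma : 'S_n) : {set 'I_n.-1} :=
  [set i | (gamma (hi i) < gamma (lo i))%N].

Definition Peak n (gamma : 'S_n) : {set 'I_n.-1} :=
  [set i : 'I_n.-1 |
    [exists h : 'I_n.-1,
       (h.+1 == i :> nat) && (gamma (lo h) < gamma (lo i))%N]
    && (gamma (hi i) < gamma (lo i))%N].

(* A permutation with descent set A, resp. with peak set B. It always exists  *)
(* for A; for B it exists as soon as B is a peak set, which is the only case  *)
(* considered (the default 1 is irrelevant).                                  *)
Definition perm_of_Des n (A : {set 'I_n.-1}) : 'S_n :=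
  odflt 1%g [pick gamma : 'S_n | Des gamma == A].
Definition perm_of_Peak n (B : {set 'I_n.-1}) : 'S_n :=
  odflt 1%g [pick gamma : 'S_n | Peak gamma == B].

(* A \ ((A + 1) U {1}); recall that the integer 1 is the ordinal 0. *)
Definition peak_part n (A : {set 'I_n.-1}) : {set 'I_n.-1} :=
  A :\: ([set i : 'I_n.-1 | [exists a in A, i == a.+1 :> nat]]
         :|: [set i : 'I_n.-1 | i == 0 :> nat]).

Definition standard n (A : {set 'I_n.-1}) (sigma : 'S_n) : bool :=
  Des sigma \subset A.

(* Here 'I_n, with its usual order, is the chain 1 < ... < n. *)
Definition ncF_chain n (A : {set 'I_n.-1}) (sigma : 'S_n) : ncseries :=
  ncF (perm_bij (perm_of_Des A)) (perm_bij sigma).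
Definition cF_chain n (A : {set 'I_n.-1}) : cseries := cF (perm_bij (perm_of_Des A)).
Arguments cF_chain : clear implicits.

Section Span.
Variables (V : lmodType rat) (G : set V).

Definition span_pred : {pred V} := fun v =>
  `[< exists k (c : 'I_k -> rat) (g : 'I_k -> V),
        (forall i, G (g i)) /\ v = \sum_i c i *: g i >].

Lemma span_submod_closed : submod_closed span_pred.
Proof.
split=> [|a u v].
  apply/asboolP; exists 0%N, (fun=> 0), (fun=> 0).
  by split=> [[]//|]; rewrite big_ord0.
move=> /asboolP[k [c [g [Gg ->]]]] /asboolP[l [e [h [Gh ->]]]].
apply/asboolP; exists (k + l)%N.
exists (fun i => match fintype.split i with inl j => a * c j | inr j => e j end).
exists (fun i => match fintype.split i with inl j => g j | inr j => h j end).
split=> [i|]; first by case: (fintype.split i).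
rewrite big_split_ord /= scaler_sumr; congr (_ + _); apply: eq_bigr => i _.
  by rewrite (unsplitK (inl _ i)) scalerA.
by rewrite (unsplitK (inr _ i)).
Qed.

HB.instance Definition _ :=
  GRing.isSubmodClosed.Build rat V span_pred span_submod_closed.

Record span := Span { span_val : V; _ : span_val \in span_pred }.

HB.instance Definition _ := [isSub for span_val].
HB.instance Definition _ := [Choice of span by <:].
HB.instance Definition _ := [SubChoice_isSubLmodule of span by <:].

Lemma mem_span v : G v -> v \in span_pred.
Proof.
move=> Gv; apply/asboolP; exists 1%N, (fun=> 1), (fun=> v).
by split=> //; rewrite big_ord1 scale1r.
Qed.

Definition span_gen v (Gv : G v) : span := Span (mem_span Gv).

End Span.

Definition NCQSym_gen : set ncseries := fun p =>
  exists n (A : {set 'I_n.-1}) (sigma : 'S_n), p = ncF_chain A sigma.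
Definition NCPi_gen : set ncseries := fun p =>
  exists d (X : finPOrderType d) n (gamma sigma : bijection X n),
    p = ncK gamma sigma.
Definition QSym_gen : set cseries := fun p =>
  exists n (A : {set 'I_n.-1}), p = cF_chain n A.
Definition Pi_gen : set cseries := fun p =>
  exists d (X : finPOrderType d) n (gamma : bijection X n), p = cK gamma.

Notation NCQSym := (span NCQSym_gen).
Notation NCPi := (span NCPi_gen).
Notation QSym := (span QSym_gen).
Notation Pi := (span Pi_gen).

Lemma NCQSym_genP n (A : {set 'I_n.-1}) (sigma : 'S_n) :
  NCQSym_gen (ncF_chain A sigma).
Proof. by exists n, A, sigma. Qed.

Lemma NCPi_genP d (X : finPOrderType d) n (gamma sigma : bijection X n) :
  NCPi_gen (ncK gamma sigma).
Proof. by exists d, X, n, gamma, sigma. Qed.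

Lemma QSym_genP n (A : {set 'I_n.-1}) : QSym_gen (cF_chain n A).
Proof. by exists n, A. Qed.

Lemma Pi_genP d (X : finPOrderType d) n (gamma : bijection X n) :
  Pi_gen (cK gamma).
Proof. by exists d, X, n, gamma. Qed.

Definition NCQSymF n (A : {set 'I_n.-1}) (sigma : 'S_n) : NCQSym :=
  span_gen (NCQSym_genP A sigma).
Definition NCPiK d (X : finPOrderType d) n (gamma sigma : bijection X n) :
  NCPi := span_gen (NCPi_genP gamma sigma).
Definition NCPiK_chain n (B : {set 'I_n.-1}) (sigma : 'S_n) : NCPi :=
  NCPiK (perm_bij (perm_of_Peak B)) (perm_bij sigma).
Definition QSymF n (A : {set 'I_n.-1}) : QSym := span_gen (QSym_genP A).
Definition PiK d (X : finPOrderType d) n (gamma : bijection X n) : Pi :=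
  span_gen (Pi_genP gamma).
Definition PiK_chain n (B : {set 'I_n.-1}) : Pi := PiK (perm_bij (perm_of_Peak B)).
Arguments QSymF : clear implicits.
Arguments PiK_chain : clear implicits.

Lemma rho_is_linear : linear rho.
Proof.
move=> a p q; apply/funext => m; rewrite /rho.
transitivity (\sum_(w <- permutations (m : seq nat)) (a * p w + q w)) => //.
by rewrite big_split /= -mulr_sumr.
Qed.

HB.instance Definition _ :=
  GRing.isLinear.Build rat ncseries cseries _ rho rho_is_linear.

Lemma rho_monomial_sum (I : choiceType) (S : set I) (w : I -> seq nat)
    (c : I -> {mset nat}) :
    (forall i, seq_mset (w i) = c i) ->
    (forall m, finite_set [set i | c i = m]%classic) ->
  rho (monomial_sum S w) = monomial_sum S c.
Proof.
move=> wc finc; apply/funext => m; rewrite /rho /monomial_sum.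
have finA : finite_set (S `&` [set i | c i = m])%classic.
  by apply: sub_finite_set (finc m) => i [].
pose r : seq I := fset_set (S `&` [set i | c i = m])%classic.
have inr i : (i \in r) = (i \in (S `&` [set i | c i = m])%classic).
  by rewrite /r in_fset_set.
have rS : ([set` r] `<=` S)%classic by move=> i /=; rewrite inr => /set_mem[].
have Nr i : S i -> i \notin r -> c i != m.
  by move=> Si; rewrite inr; apply: contra => /eqP ci; apply/mem_set.
rewrite (fsbigE r) ?fset_uniq //; last first.
  by move=> i Si /(Nr _ Si) /negPf ->.
rewrite (eq_big_seq (fun u => \sum_(i <- r | i \in S) ((w i == u)%:R : rat))).
  rewrite exchange_big /= big_seq_cond [RHS]big_seq_cond.
  apply: eq_bigr => i /andP[]; rewrite inr => /set_mem[_ /= ci] _.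
  rewrite ci eqxx (bigD1_seq (w i)) ?permutations_uniq //=.
    rewrite eqxx big1 ?addr0 // => u; rewrite eq_sym => /negPf -> //.
  rewrite mem_permutations -ci -wc perm_sym; exact: perm_eq_seq_mset.
move=> u; rewrite mem_permutations => um.
rewrite (fsbigE r) ?fset_uniq //.
move=> i Si /(Nr _ Si) ci; case: eqP => // wu; case/eqP: ci.
by rewrite -wc wu -(seq_mset_id m); apply/eq_seq_msetP.
Qed.

Lemma seq_mset_word (X : finType) n (sigma : bijection X n) (g : X -> nat) :
  seq_mset (word sigma g) = content g.
Proof.
apply/eq_seq_msetP; rewrite /word (map_comp g); apply: perm_map.
apply: uniq_perm; rewrite ?enum_uniq //.
  by rewrite map_inj_uniq ?enum_uniq //; exact: can_inj (@bij_invK _ _ sigma).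
move=> a; rewrite mem_enum inE; apply/mapP; exists (sigma a).
  by rewrite mem_enum.
by rewrite bij_funK.
Qed.

Lemma finite_content (X : finType) (T : choiceType) (v : T -> nat)
    (t : nat -> seq T) (vt : forall x, x \in t (v x)) (m : {mset nat}) :
  finite_set [set f : {ffun X -> T} | content (fun a => v (f a)) = m]%classic.
Proof.
pose s := flatten [seq t k | k <- m : seq nat].
pose h (g : {ffun X -> seq_sub s}) : {ffun X -> T} := [ffun a => ssval (g a)].
apply: sub_finite_set (finite_image h (@finite_finset _ setT)) => f /= fm.
have fs a : f a \in s.
  apply/flattenP; exists (t (v (f a))) => //; apply: map_f.
  rewrite -fm (perm_mem (perm_eq_seq_mset _)).
  by apply: (map_f (fun b => v (f b))); rewrite mem_enum.
by exists [ffun a => SeqSub (fs a)] => //; apply/ffunP => a; rewrite !ffunE.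
Qed.

Lemma rho_ncF d (X : finPOrderType d) n (gamma sigma : bijection X n) :
  rho (ncF gamma sigma) = cF gamma.
Proof.
apply: rho_monomial_sum => [f|m]; first exact: seq_mset_word.
by apply: (@finite_content X nat id (fun k => [:: k])) => k; rewrite inE.
Qed.

Lemma rho_ncK d (X : finPOrderType d) n (gamma sigma : bijection X n) :
  rho (ncK gamma sigma) = cK gamma.
Proof.
apply: rho_monomial_sum => [f|m]; first exact: seq_mset_word.
apply: (@finite_content X int absz (fun k => [:: k%:Z; - k%:Z])) => x.
by rewrite !inE; case: x => k //=; rewrite ?eqxx // NegzE eqxx orbT.
Qed.

Lemma rho_span (G : set ncseries) (H : set cseries) :
    (forall p, G p -> H (rho p)) ->
  forall p : span G, rho (val p) \in span_pred H.
Proof.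
move=> GH [p /= /asboolP[k [c [g [Gg ->]]]]].
apply/asboolP; exists k, c, (rho \o g); split=> [i|]; first exact/GH.
by rewrite linear_sum; apply: eq_bigr => i _; rewrite linearZ.
Qed.

Lemma rho_NCQSym_subproof p : NCQSym_gen p -> QSym_gen (rho p).
Proof. by case=> n [A [sigma ->]]; rewrite rho_ncF; exact: QSym_genP. Qed.

Lemma rho_NCPi_subproof p : NCPi_gen p -> Pi_gen (rho p).
Proof.
by case=> d [X [n [gamma [sigma ->]]]]; rewrite rho_ncK; exact: Pi_genP.
Qed.

Definition rho_NCQSym (p : NCQSym) : QSym :=
  Span (rho_span rho_NCQSym_subproof p).
Definition rho_NCPi (p : NCPi) : Pi := Span (rho_span rho_NCPi_subproof p).

Definition is_Theta_NCQSym (T : {linear NCQSym -> NCPi}) : Prop :=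
  forall n (A : {set 'I_n.-1}) (sigma : 'S_n), standard A sigma ->
    T (NCQSymF A sigma) = NCPiK_chain (peak_part A) sigma.

Definition is_Theta_QSym (T : {linear QSym -> Pi}) : Prop :=
  forall n (A : {set 'I_n.-1}), T (QSymF n A) = PiK_chain n (peak_part A).

(* "The" linear map satisfying P. The default value 0 does not satisfy the    *)
(* predicates above, so an identity showing that the map chosen takes their   *)
(* nonzero values shows in particular that such a map exists.                 *)
Definition the_linear (U V : lmodType rat) (P : {linear U -> V} -> Prop) :
    {linear U -> V} :=
  if pselect (exists T, P T) is left exT then sval (cid exT) else \0.

Definition Theta_NCQSym : {linear NCQSym -> NCPi} :=
  the_linear is_Theta_NCQSym.
Definition Theta_QSym : {linear QSym -> Pi} := the_linear is_Theta_QSym.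

(* Main.v *)
Require Import Defs.
From mathcomp Require Import boolp classical_sets functions cardinality fsbigop.
From HB Require Import structures.
From mathcomp Require Import all_boot all_order all_algebra all_fingroup.
From mathcomp Require Import finmap multiset.
From mathcomp Require Import zify lra.

(* Theta is the restriction of an explicit linear operator [theta] on all     *)
(* noncommutative series. In an enriched partition the letters -k form a set  *)
(* on which the labelling is order-reversing, and a reciprocity writes the    *)
(* indicator of "order-reversing on N" as an alternating sum, over the        *)
(* ordered set partitions of N, of indicators of (P,gamma)-partitions. Hence  *)
(* each coefficient of K_(P,gamma,sigma) is a combination, independent of     *)
(* P and gamma, of coefficients of F_(P,gamma,sigma). It remains to see that  *)
(* the standard F_(A,sigma) span NCQSym (by triangularity against the         *)
(* monomial basis) and that for a chain K depends only on the peak set.       *)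
(* In QSym, Theta is rho \o theta \o s, where the section s of rho puts each  *)
(* monomial in weakly increasing order and maps F_A to F_(A,1).               *)

Set Implicit Arguments.
Unset Strict Implicit.
Unset Printing Implicit Defensive.

Import Order.TTheory GRing.Theory Num.Theory.
Local Open Scope ring_scope.

(** One operator [theta], blind to P and gamma, sends every F_(P,gamma,sigma) to K_(P,gamma,sigma)
    ([theta_ncF]). Fix a word of absolute values and the set N of negative positions. The signs give
    an enriched partition iff values increase weakly along the order and, among equal values, no
    positive position lies below a negative one, while labels decrease on negative and increase on
    positive related pairs. The reversed condition on N is an alternating sum of ordinary ones
    ([sum_cut], [altsum_blocks]), and [lexrank] turns each term into a coefficient of F.

    For a chain, counting the admissible sign sets ([sum_enriched_ok]) shows that K depends only on
    the peak set, so [theta] satisfies the formula that specifies Theta on standard pairs. Standard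
    F span everything needed ([ncM_span], [ncF_span]), so Theta is the restriction of [theta], and
    (1) and (2) are instances of [theta_ncF]. For (3), both sides are linear and agree on each
    F_(A,tau), because [rho] forgets tau. *)

Lemma forall2_andin (Y : finType) (N : {set Y}) (p q u : Y -> Y -> bool) :
    (forall a b, p a b = q a b && ((a \in N) ==> ((b \in N) ==> u a b))) ->
  [forall a, forall b, p a b] =
  [forall a, forall b, q a b] && [forall a in N, forall b in N, u a b].
Proof.
move=> pq; apply/forallP/andP => [H|[/forallP H0 /forall_inP H1] a].
  split; first by apply/forallP => a; apply/forallP => b;
    have /forallP/(_ b) := H a; rewrite pq => /andP[].
  apply/forall_inP => a Na; apply/forall_inP => b Nb.
  by have /forallP/(_ b) := H a; rewrite pq Na Nb => /andP[].
apply/forallP => b; rewrite pq; have /forallP/(_ b) -> := H0 a => /=.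
apply/implyP => Na; apply/implyP => Nb.
by have /forall_inP/(_ b Nb) := H1 a Na.
Qed.

(** * Reciprocity between order-reversing and ordinary conditions *)

Section Reciprocity.
Variables (Y : finType) (r : rel Y) (g : Y -> nat).
Implicit Types (N I : {set Y}) (c : Y -> nat).

(** The condition on a related pair of N once I is split off as the lowest block: ordinary inside I,
    still reversed outside it. For I empty it is the fully reversed condition. *)
Definition cut_ok I a b : bool :=
  if a \in I then (b \in I) ==> (g a < g b)%N
  else (b \notin I) && (g b < g a)%N.

(* Elements of N are still to be distributed into blocks: among them the      *)
(* condition on values is replaced by the order-reversing one.                *)
Definition blocks_ok N c : bool :=
  [forall a, forall b, r a b ==>
     (if (a \in N) && (b \in N) then (g b < g a)%N
      else (c a < c b)%N || (c a == c b) && (g a < g b)%N)].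

Definition partition_ok c : bool :=
  [forall a, forall b, r a b ==>
     ((c a < c b)%N || (c a == c b) && (g a < g b)%N)].

(* The alternating sum over the ordered set partitions (I_1, ..., I_k) of N: *)
(* the value of c on N is raised by j - 1 on I_j. The fuel m must be at least *)
(* #|N|.                                                                      *)
Fixpoint altsum m N c (h : (Y -> nat) -> rat) : rat :=
  if N == set0 then h c else
  if m is m'.+1 then
    \sum_(I in powerset N | I != set0)
      (-1) ^+ #|I|.+1 *
        altsum m' (N :\: I) (fun a => (c a + (a \in N :\: I))%N) h
  else 0.

Lemma blocks_ok0 c : blocks_ok set0 c = partition_ok c.
Proof. by apply: eq_forallb => a; apply: eq_forallb => b; rewrite !inE. Qed.

Lemma altsumD m N c h1 h2 :
  altsum m N c (fun c' => h1 c' + h2 c') = altsum m N c h1 + altsum m N c h2.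
Proof.
elim: m N c => [|m IH] N c /=; case: eqP => // _.
by rewrite -big_split; apply: eq_bigr => I _; rewrite IH mulrDr.
Qed.

Lemma altsumZ m N c h (x : rat) :
  altsum m N c (fun c' => x * h c') = x * altsum m N c h.
Proof.
elim: m N c => [|m IH] N c /=; case: eqP => // _; first by rewrite mulr0.
by rewrite mulr_sumr; apply: eq_bigr => I _; rewrite IH mulrCA.
Qed.

Hypothesis (g_inj : injective g) (r_irr : irreflexive r).

(* Adding or removing from I the element of N with the largest label does not *)
(* change the condition on I, so that the terms cancel in pairs.              *)
Lemma sum_cut N : N != set0 ->
  \sum_(I in powerset N) (-1) ^+ #|I| *
    [forall a in N, forall b in N, r a b ==> cut_ok I a b]%:R = 0 :> rat.
Proof.
case/set0Pn=> x0 Nx0.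
have [x Nx xmax] : exists2 x, x \in N & forall a, a \in N -> a != x -> (g a < g x)%N.
  case: (@arg_maxnP _ x0 (mem N) g Nx0) => x Nx xm; exists x => // a Na ax.
  by rewrite ltn_neqAle (xm a Na : g a <= g x)%N andbT (inj_eq g_inj).
pose t I := if x \in I then I :\ x else x |: I.
have tK : involutive t.
  move=> I; rewrite /t; case xI: (x \in I); first by rewrite !inE eqxx /= setD1K.
  by rewrite setU11 setU1K // xI.
have tE I a : (a \in t I) = (a \in I) (+) (a == x).
  rewrite /t; case: ifPn => xI; rewrite !inE; case: eqP => [->|_] /=;
    rewrite ?xI ?(negPf xI) ?addbF ?andbT //.
set S := \sum_(I in _) _.
suff: S = - S by move=> ?; lra.
rewrite {1}/S (reindex_inj (can_inj tK)) /= -sumrN.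
apply: eq_big => [I|I NI].
  rewrite !powersetE; apply/subsetP/subsetP => H a aI.
    case: (eqVneq a x) => [->//|ax]; apply: H.
    by rewrite tE aI (negPf ax).
  move: aI; rewrite tE; case: (eqVneq a x) => [->//|ax].
  by rewrite addbF; apply: H.
rewrite -mulNr; congr (_ * _).
  rewrite /t; case: ifPn => xI.
    by rewrite [in RHS](cardsD1 x) xI exprS mulN1r opprK.
  by rewrite cardsU1 xI exprS mulN1r.
congr (_%:R); congr nat_of_bool.
apply: eq_forallb => a; case: (boolP (a \in N)) => //= Na.
apply: eq_forallb => b; case: (boolP (b \in N)) => //= Nb.
case rab: (r a b) => //=; rewrite /cut_ok !tE.
case: (eqVneq a x) => [ax|ax]; case: (eqVneq b x) => [bx|bx].
- by rewrite ax bx r_irr in rab.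
- have := xmax _ Nb bx; rewrite ax.
  by case: (x \in I); case: (b \in I) => /=; lia.
- have := xmax _ Na ax; rewrite bx.
  by case: (x \in I); case: (a \in I) => /=; lia.
- by rewrite !addbF.
Qed.

(** By [sum_cut], the reversed condition on N (the term of the empty I) is the signed sum over the
    nonempty first blocks I; induction treats N minus I. The hypotheses on [c] reserve the values
    from k to k + #|N| - 1 for the at most #|N| blocks. *)
Lemma altsum_blocks m N c k : (#|N| <= m)%N ->
    (forall a, a \in N -> c a = k) ->
    (forall a, a \notin N -> (c a < k)%N || (k + #|N| <= c a)%N) ->
  altsum m N c (fun c' => (partition_ok c')%:R) = (blocks_ok N c)%:R.
Proof.
elim: m N c k => [|m IH] N c k Nm cN cNN /=.
  by have -> : N = set0 by [apply/eqP; rewrite -cards_eq0; lia]; rewrite eqxx blocks_ok0.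
case: eqVneq => [->|N0]; first by rewrite blocks_ok0.
have Npos : (0 < #|N|)%N by rewrite card_gt0.
(* [Q0] concerns the pairs not inside N, which raising N minus I leaves unaffected; [Q1 I] concerns
   those inside N. *)
pose Q0 : bool := [forall a, forall b, r a b ==>
     (if (a \in N) && (b \in N) then true
      else (c a < c b)%N || (c a == c b) && (g a < g b)%N)].
pose Q1 I := [forall a in N, forall b in N, r a b ==> cut_ok I a b].
have E (I : {set Y}) : I \subset N -> I != set0 ->
    blocks_ok (N :\: I) (fun a => c a + (a \in N :\: I))%N = Q0 && Q1 I.
  move=> IN I0; apply: forall2_andin => a b.
  case rab: (r a b) => /=; last by rewrite !implybT.
  (* This keeps the raised value k + 1 below k + #|N|, hence below every larger value taken outside
     N. *)
  have N1 y : y \in N -> y \notin I -> (1 < #|N|)%N.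
    move=> Ny yI; apply: (@leq_trans #|I|.+1); first by rewrite ltnS card_gt0.
    by apply: proper_card; apply/properP; split=> //; exists y.
  rewrite !inE /cut_ok.
  move/subsetP: IN => IN.
  move: (IN a) (IN b) (cN a) (cN b) (cNN a) (cNN b) (N1 a) (N1 b).
  case: (a \in I); case: (b \in I); case: (a \in N); case: (b \in N) => //=;
    move=> H1 H2 H3 H4 H5 H6 H7 H8;
    try (by move: (H1 isT)); try (by move: (H2 isT));
    try move: (H3 isT) => {}H3; try move: (H4 isT) => {}H4;
    try move: (H5 isT) => {}H5; try move: (H6 isT) => {}H6;
    try move: (H7 isT isT) => {}H7; try move: (H8 isT isT) => {}H8;
    by lia.
have E0 : blocks_ok N c = Q0 && Q1 set0.
  apply: forall2_andin => a b; rewrite /cut_ok !inE.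
  by case: (r a b); case: (a \in N); case: (b \in N); rewrite /= ?andbT.
transitivity (\sum_(I in powerset N | I != set0)
      (-1) ^+ #|I|.+1 * ((Q0 && Q1 I)%:R : rat)).
  apply: eq_bigr => I /andP[]; rewrite powersetE => IN I0; congr (_ * _).
  have cI : (0 < #|I|)%N by rewrite card_gt0.
  have cD : #|N :\: I| = (#|N| - #|I|)%N by rewrite cardsD (setIidPr IN).
  have lI : (#|I| <= #|N|)%N by apply: subset_leq_card.
  rewrite (IH _ _ k.+1).
  - by rewrite E.
  - by rewrite cD; lia.
  - by move=> a aD; rewrite aD cN ?addn1 //; move: aD; rewrite inE => /andP[].
  - move=> a aD; rewrite (negPf aD) addn0 cD; move: aD; rewrite inE negb_and negbK.
    case/orP => [aI|/cNN aN]; last by lia.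
    by rewrite cN ?ltnS ?leqnn //; move/subsetP: IN; apply.
rewrite E0; case: (Q0) => /=; last by rewrite big1 // => I _; rewrite mulr0.
have := sum_cut N0; rewrite (bigD1 set0) ?powersetE ?sub0set //= cards0 mul1r.
rewrite -/(Q1 set0) => /eqP; rewrite addr_eq0 => /eqP ->.
by rewrite -sumrN; apply: eq_bigr => I _; rewrite exprS mulN1r mulNr.
Qed.

End Reciprocity.

(** * Lexicographic ranks *)

Section LexRank.
Variables (Y : finType) (w c : Y -> nat).

Definition lexlt a b : bool := (w a < w b)%N || (w a == w b) && (c a < c b)%N.
(* A map to nat with the order type of (w, c) ordered lexicographically. *)
Definition lexrank a : nat := #|[set b | lexlt b a]|.

Lemma lexrank_lt a b : (lexrank a < lexrank b)%N = lexlt a b.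
Proof.
apply/idP/idP => [|ab]; last first.
  apply: proper_card; apply/properP; split.
    by apply/subsetP => y; move: ab; rewrite !inE /lexlt; lia.
  by exists a; move: ab; rewrite !inE /lexlt; lia.
apply: contraTT => ab; rewrite -leqNgt; apply: subset_leq_card.
by apply/subsetP => y; move: ab; rewrite !inE /lexlt; lia.
Qed.

Lemma lexrank_eq a b :
  (lexrank a == lexrank b) = (w a == w b) && (c a == c b).
Proof.
have := lexrank_lt a b; have := lexrank_lt b a; rewrite /lexlt; lia.
Qed.

Lemma ltn_lexrank a : (lexrank a < #|Y|)%N.
Proof.
rewrite -cardsT; apply: proper_card; apply/properP; split.
  by apply/subsetP => y _; rewrite inE.
by exists a; rewrite ?inE // /lexlt; lia.
Qed.

End LexRank.

(** * The enriched condition as an alternating sum *)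

Section Enriched.
Variables (Y : finType) (r : rel Y) (g : Y -> nat).
Hypothesis (g_inj : injective g) (r_irr : irreflexive r).

(* N is the set of the a with a negative value, w a the absolute value. *)
Definition enriched_ok (N : {set Y}) (w : Y -> nat) : bool :=
  [forall a, forall b, r a b ==>
    ((w a < w b)%N || (w a == w b) &&
     (if a \in N then (b \in N) ==> (g b < g a)%N
      else (b \notin N) && (g a < g b)%N))].

Lemma partition_ok_lexrank w c :
  partition_ok r g (fun a => (lexrank w c a).+1) =
  [forall a, forall b, r a b ==> (w a <= w b)%N] &&
  partition_ok [rel a b | r a b && (w a == w b)] g c.
Proof.
transitivity ([forall a, forall b, r a b ==> (w a <= w b)%N] &&
  [forall a in [set: Y], forall b in [set: Y],
     (r a b && (w a == w b)) ==> ((c a < c b)%N || (c a == c b) && (g a < g b)%N)]).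
  apply: forall2_andin => a b; rewrite !inE ltnS eqSS lexrank_lt lexrank_eq.
  by rewrite /lexlt /=; case: (r a b) => //=; lia.
congr (_ && _); apply: eq_forallb => a; rewrite inE /=.
by apply: eq_forallb => b; rewrite inE.
Qed.

(** Only pairs tied for [w] constrain [c]. Starting at 0 on N and at #|N| off N puts negative
    positions below positive ones and leaves room for all blocks of N. *)
Lemma altsum_enriched (N : {set Y}) (w : Y -> nat) :
  altsum #|N| N (fun a => if a \in N then 0%N else #|N|)
    (fun c => (partition_ok r g (fun a => (lexrank w c a).+1))%:R) =
  (enriched_ok N w)%:R.
Proof.
set mono := [forall a, forall b, r a b ==> (w a <= w b)%N].
set r' := [rel a b | r a b && (w a == w b)].
have -> : (fun c => (partition_ok r g (fun a => (lexrank w c a).+1))%:R) =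
    (fun c => mono%:R * (partition_ok r' g c)%:R : rat).
  by apply/funext => c; rewrite partition_ok_lexrank -natrM mulnb.
rewrite altsumZ (@altsum_blocks _ r' g g_inj _ _ _ _ 0%N) //; last 3 first.
- by move=> a; rewrite /r' /= r_irr.
- by move=> a ->.
- by move=> a /negPf ->; rewrite add0n leqnn orbT.
rewrite -natrM mulnb; congr (_%:R); congr nat_of_bool.
transitivity (mono &&
  [forall a in [set: Y], forall b in [set: Y], r' a b ==> 
     (if a \in N then (b \in N) ==> (g b < g a)%N
      else (b \notin N) && (g a < g b)%N)]).
  congr (_ && _); apply: eq_forallb => a; rewrite inE /=.
  apply: eq_forallb => b; rewrite inE /=.
  case: (boolP (r a b && (w a == w b))) => //= _.
  case: (boolP (a \in N)) => aN; case: (boolP (b \in N)) => bN //=.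
  - have : (0 < #|N|)%N by rewrite card_gt0; apply/set0Pn; exists a.
    by lia.
  - have : (0 < #|N|)%N by rewrite card_gt0; apply/set0Pn; exists b.
    by lia.
  - by lia.
apply/esym; apply: forall2_andin => a b; rewrite !inE /r' /=.
by case: (r a b) => //=; lia.
Qed.

End Enriched.

(** * Coefficients of F and K *)

Lemma monomial_sumE (M I : choiceType) (S : set I) (mon : I -> M) m (s : seq I) :
    uniq s -> (forall i, S i -> (mon i == m) = (i \in s)) ->
  monomial_sum S mon m = \sum_(i <- s) `[< S i >]%:R.
Proof.
move=> s_uniq sE; rewrite /monomial_sum.
rewrite (fsbigE [seq i <- s | `[< S i >]]) ?filter_uniq //.
- rewrite big_filter_cond [RHS](bigID (fun i => `[< S i >])) /= [X in _ = _ + X]big1 ?addr0.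
    rewrite big_seq_cond [RHS]big_seq_cond; apply: eq_big => [i|i].
      by case: asboolP => //= Si; rewrite mem_set.
    move=> /and3P[is_ /asboolP Si _].
    by rewrite sE // is_ asboolT.
  by move=> i /negPf ->.
- by move=> i /=; rewrite mem_filter => /andP[/asboolP].
- by move=> i Si; rewrite mem_filter asboolT //= sE // => /negPf ->.
Qed.

Lemma word_eq (X : finType) n (sigma : bijection X n) (u : X -> nat) w :
  (word sigma u == w) =
  (size w == n) && [forall a, u a == nth 0%N w (sigma a)].
Proof.
rewrite /word; apply/eqP/andP => [<-|[/eqP sw /forallP uw]].
  rewrite size_map size_enum_ord; split=> //; apply/forallP => a.
  rewrite (nth_map (sigma a)) ?size_enum_ord ?ltn_ord //.
  by rewrite nth_ord_enum bij_funK.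
apply: (@eq_from_nth _ 0%N) => [|i]; rewrite size_map size_enum_ord ?sw // => ilt.
rewrite (nth_map (Ordinal ilt)) ?size_enum_ord //.
rewrite (nth_ord_enum _ (Ordinal ilt)).
by rewrite (eqP (uw _)) bij_invK.
Qed.

Section Coefficients.
Variables (d : Order.disp_t) (X : finPOrderType d) (n : nat).
Variables (gamma sigma : bijection X n).

(* The poset and its labelling, transported to the positions in a word. *)
Definition pos_lt : rel 'I_n := fun i j => (bij_inv sigma i < bij_inv sigma j)%O.
Definition pos_label (i : 'I_n) : nat := gamma (bij_inv sigma i).

Lemma pos_lt_irr : irreflexive pos_lt.
Proof. by move=> i; rewrite /pos_lt ltxx. Qed.

Lemma pos_label_inj : injective pos_label.
Proof.
move=> i j /val_inj /(can_inj (@bij_funK _ _ gamma)).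
exact: (can_inj (@bij_invK _ _ sigma)).
Qed.

Lemma is_partitionE (u : 'I_n -> nat) :
  is_partition gamma (fun a => u (sigma a)) <->
  (forall i, (0 < u i)%N) /\ partition_ok pos_lt pos_label u.
Proof.
split=> [[u0 ule ult]|[u0 /forallP uok]].
  split=> [i|]; first by have := u0 (bij_inv sigma i); rewrite bij_invK.
  apply/forallP => i; apply/forallP => j; apply/implyP => ij.
  have := ule _ _ (ltW ij); have := ult _ _ (ltW ij); rewrite !bij_invK.
  rewrite -/(pos_label i) -/(pos_label j).
  have : pos_label i != pos_label j.
    by apply: contraTneq ij => /pos_label_inj ->; rewrite pos_lt_irr.
  by lia.
have key a b : (a < b)%O ->
    (u (sigma a) < u (sigma b))%N || (u (sigma a) == u (sigma b)) && (gamma a < gamma b)%N.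
  move=> ab; have /forallP/(_ (sigma b)) := uok (sigma a).
  by rewrite /pos_lt /pos_label !bij_funK ab.
split=> // a b; rewrite le_eqVlt => /orP[/eqP->|/key]; lia.
Qed.

Lemma ncF_coef w : ncF gamma sigma w =
  ((size w == n) && (0%N \notin w) &&
   partition_ok pos_lt pos_label (fun i => nth 0%N w i))%:R.
Proof.
have [sw|sw] := eqVneq (size w) n; last first.
  rewrite /ncF (@monomial_sumE _ _ _ _ _ [::]) ?big_nil // => f _.
  by rewrite word_eq (negPf sw).
pose f : {ffun X -> nat} := [ffun a => nth 0%N w (sigma a)].
rewrite /ncF (@monomial_sumE _ _ _ _ _ [:: f]) ?big_seq1 //; last first.
  move=> g _; rewrite word_eq sw eqxx inE /=.
  apply/forallP/eqP => [gw|-> a]; last by rewrite ffunE.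
  by apply/ffunP => a; rewrite ffunE (eqP (gw a)).
congr (_%:R); congr nat_of_bool; rewrite /=.
have fE : f = (fun a => nth 0%N w (sigma a)) :> (X -> nat).
  by apply/funext => a; rewrite ffunE.
rewrite fE; apply/asboolP/andP.
  move=> /(is_partitionE (fun i => nth 0%N w i))[w0 ->]; split=> //.
  apply/negP => /(nthP 0%N)[i]; rewrite sw => ilt i0.
  by have := w0 (Ordinal ilt); rewrite /= i0.
move=> [w0 ?]; apply/(is_partitionE (fun i => nth 0%N w i)); split=> // i.
by rewrite lt0n; apply: contraNneq w0 => <-; rewrite mem_nth // sw.
Qed.

(** Any f whose absolute values spell [w] has this form: only the signs are free. *)
Definition signed (w : seq nat) (N : {set 'I_n}) : {ffun X -> int} :=
  [ffun a => if sigma a \in N then - (nth 0%N w (sigma a))%:Z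
             else (nth 0%N w (sigma a))%:Z].

Lemma is_enriched_partitionE w (N : {set 'I_n}) :
    (forall i : 'I_n, 0 < nth 0%N w i)%N ->
  is_enriched_partition gamma (signed w N) <->
  enriched_ok pos_lt pos_label N (fun i => nth 0%N w i).
Proof.
move=> w0.
have key a b : (a < b)%O ->
   [/\ enriched_le (signed w N a) (signed w N b),
        signed w N a = signed w N b -> 0 < signed w N a -> (gamma a < gamma b)%N
      & signed w N a = signed w N b -> signed w N a < 0 -> (gamma b < gamma a)%N] <->
   (nth 0 w (sigma a) < nth 0 w (sigma b))%N ||
     (nth 0 w (sigma a) == nth 0 w (sigma b))%N &&
     (if sigma a \in N then (sigma b \in N) ==> (gamma b < gamma a)%N
      else (sigma b \notin N) && (gamma a < gamma b)%N).
  move=> ab; rewrite !ffunE /enriched_le.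
  have := w0 (sigma a); have := w0 (sigma b).
  move: (nth 0 w (sigma a))%N (nth 0 w (sigma b))%N => x y.
  case: (sigma a \in N); case: (sigma b \in N) => /= y0 x0;
    (split=> [[H1 H2 H3]|H]; [ | split]); lia.
split=> [[_ H]|/forallP H].
  apply/forallP => i; apply/forallP => j; apply/implyP => ij.
  by have /(key _ _ ij) := H _ _ ij; rewrite !bij_invK.
split=> [a|a b ab].
  by rewrite ffunE; have := w0 (sigma a); case: ifP => _; lia.
apply/key => //; have /forallP/(_ (sigma b)) := H (sigma a).
by rewrite /pos_lt /pos_label !bij_funK ab.
Qed.

Lemma ncK_coef w : ncK gamma sigma w =
  if (size w == n) && (0%N \notin w) then
    \sum_(N : {set 'I_n})
      (enriched_ok pos_lt pos_label N (fun i => nth 0%N w i))%:R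
  else 0.
Proof.
case: ifPn => [/andP[/eqP sw w0]|wbad]; last first.
  rewrite /ncK (@monomial_sumE _ _ _ _ _ [::]) ?big_nil // => f [f0 _].
  rewrite word_eq in_nil; apply: contraNF wbad => /andP[sw /forallP fw].
  rewrite sw; apply/negP => /(nthP 0%N)[i]; rewrite (eqP sw) => ilt wi.
  have := fw (bij_inv sigma (Ordinal ilt)); rewrite bij_invK /= wi.
  by have := f0 (bij_inv sigma (Ordinal ilt)); lia.
have wpos (i : 'I_n) : (0 < nth 0 w i)%N.
  by rewrite lt0n; apply: contraNneq w0 => <-; rewrite mem_nth // sw.
rewrite /ncK (@monomial_sumE _ _ _ _ _ [seq signed w N | N <- enum {: {set 'I_n}}]).
- rewrite big_map big_enum; apply: eq_bigr => N _.
  congr (_%:R); congr nat_of_bool.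
  by apply/asboolP/idP => /(is_enriched_partitionE _ wpos).
- rewrite map_inj_uniq ?enum_uniq // => N1 N2 /ffunP N12.
  apply/setP => i; have := N12 (bij_inv sigma i); rewrite !ffunE bij_invK.
  by have := wpos i; do 2!case: ifP => _; lia.
- move=> f _; rewrite word_eq sw eqxx /=; apply/forallP/mapP => [fw|[N _ ->] a].
    exists [set i | f (bij_inv sigma i) < 0]; first by rewrite mem_enum.
    apply/ffunP => a; rewrite ffunE inE bij_funK -(eqP (fw a)).
    have sgE (z : int) : z = if z < 0 then - `|z|%N%:Z else `|z|%N%:Z.
      by case: ifP; lia.
    exact: sgE.
  by rewrite ffunE; case: ifP; lia.
Qed.

End Coefficients.

(** * The operator theta *)

Lemma altsum0 (Y : finType) m (N : {set Y}) c : altsum m N c (fun=> 0) = 0.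
Proof.
elim: m N c => [|m IH] N c /=; case: eqP => // _.
by apply: big1 => I _; rewrite IH mulr0.
Qed.

(** N runs over the possible sets of negative positions, as in [altsum_enriched]. The successor
    keeps letters positive, since the index 0 never occurs. *)
Definition theta_n n (p : ncseries) (w : seq nat) : rat :=
  \sum_(N : {set 'I_n})
    altsum #|N| N (fun i => if i \in N then 0%N else #|N|)
      (fun c => p [seq (lexrank (fun j : 'I_n => nth 0%N w j) c i).+1 |
                    i <- enum 'I_n]).

Definition theta (p : ncseries) : ncseries :=
  fun w => if 0%N \in w then 0 else theta_n (size w) p w.

Lemma theta_is_linear : linear theta.
Proof.
move=> x p q; apply/funext => w.
transitivity (x * theta p w + theta q w) => //; rewrite /theta.
case: ifP => _; first by rewrite mulr0 addr0.
rewrite /theta_n mulr_sumr -big_split; apply: eq_bigr => N _ /=.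
by rewrite -altsumZ -altsumD.
Qed.

HB.instance Definition _ :=
  GRing.isLinear.Build rat ncseries ncseries _ theta theta_is_linear.

Lemma theta_ncF d (X : finPOrderType d) n (gamma sigma : bijection X n) :
  theta (ncF gamma sigma) = ncK gamma sigma.
Proof.
apply/funext => w; rewrite ncK_coef /theta.
case: ifP => w0; first by rewrite andbF.
rewrite /= andbT; have [sw|sw] := eqVneq (size w) n; last first.
  apply: big1 => N _.
  rewrite -[RHS](altsum0 #|N| N (fun i => if i \in N then 0%N else #|N|)).
  congr altsum; apply/funext => c; rewrite ncF_coef size_map size_enum_ord.
  by rewrite (negPf sw).
rewrite sw; apply: eq_bigr => N _.
rewrite -(altsum_enriched (@pos_label_inj _ _ _ gamma sigma) (@pos_lt_irr _ _ _ sigma)).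
congr altsum; apply/funext => c; rewrite ncF_coef size_map size_enum_ord eqxx /=.
have -> : 0%N \notin [seq (lexrank (fun j : 'I_n => nth 0%N w j) c i).+1 |
                        i <- enum 'I_n].
  by apply/mapP => -[].
congr (_%:R); congr nat_of_bool; rewrite /=; congr partition_ok.
apply/funext => i; rewrite (nth_map i) ?size_enum_ord //.
by rewrite (nth_ord_enum _ i).
Qed.

(** * Chains and peak sets *)

Lemma card_between (T : finType) (V W : {set T}) : V \subset W ->
  #|[set N : {set T} | (V \subset N) && (N \subset W)]| = (2 ^ (#|W| - #|V|))%N.
Proof.
move=> VW.
have -> : (#|W| - #|V|)%N = #|W :\: V| by rewrite cardsD (setIidPr VW).
rewrite -card_powerset -[RHS](card_in_imset (f := fun N => V :|: N)).
  apply: eq_card => N; rewrite !inE; apply/andP/imsetP => [[VN NW]|[M]].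
    exists (N :\: V); first by rewrite powersetE setSD.
    by rewrite -{1}(setIidPr VN) setID.
  rewrite powersetE subsetD => /andP[MW _] ->.
  by rewrite subsetUl subUset VW MW.
move=> M1 M2; rewrite !powersetE !subsetD => /andP[_ d1] /andP[_ d2] VM.
have := congr1 (fun N => N :\: V) VM; rewrite !setDUl setDv !set0U.
by rewrite (setDidPl d1) (setDidPl d2).
Qed.

Lemma chain_rel n (R : rel 'I_n) :
    (forall i j k : 'I_n, R i j -> R j k -> R i k) ->
  (forall i j : 'I_n, (i < j)%N -> R i j) <-> (forall h, R (lo h) (hi h)).
Proof.
move=> Rtr; split=> [H h|H i j ij]; first by apply: H => /=.
have [m] := ubnP (j - i)%N; elim: m => // m IH in i j ij *.
rewrite ltnS leq_eqVlt => /orP[/eqP jim|]; last exact: IH.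
have ilt : (i < n.-1)%N by have := ltn_ord j; lia.
have lohE : i = lo (Ordinal ilt) by apply: val_inj.
have := H (Ordinal ilt); rewrite -lohE.
have [<-//|hj] := eqVneq (hi (Ordinal ilt)) j.
have hj' : ((hi (Ordinal ilt) : nat) != j) by [].
move: hj'; rewrite /= => hj' /Rtr; apply; apply: IH => /=; lia.
Qed.

Section Chain.
Variables (n : nat) (gamma sigma : 'S_n).

Lemma forall_pos_lt (R : rel 'I_n) :
    (forall i j k : 'I_n, R i j -> R j k -> R i k) ->
  [forall i, forall j,
     pos_lt (perm_bij sigma) i j ==> R (sigma^-1%g i) (sigma^-1%g j)] =
  [forall h, R (lo h) (hi h)].
Proof.
move=> Rtr; apply/forallP/forallP => [H|/(chain_rel Rtr) H i].
  apply/(chain_rel Rtr) => i j ij; have /forallP/(_ (sigma j)) := H (sigma i).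
  by rewrite /pos_lt /= !permK ltEord /= ij.
apply/forallP => j; apply/implyP; rewrite /pos_lt ltEord; exact: H.
Qed.

Lemma notin_DesE (h : 'I_n.-1) :
  (gamma (lo h) < gamma (hi h))%N = (h \notin Des gamma).
Proof.
rewrite inE -leqNgt [RHS]leq_eqVlt.
have -> // : (gamma (lo h) == gamma (hi h) :> nat) = false.
by apply/eqP => /val_inj /perm_inj /(congr1 val) /=; lia.
Qed.

Lemma partition_ok_chain u :
  partition_ok (pos_lt (perm_bij sigma))
    (pos_label (perm_bij gamma) (perm_bij sigma)) u =
  [forall h : 'I_n.-1, (u (sigma (lo h)) < u (sigma (hi h)))%N ||
     (u (sigma (lo h)) == u (sigma (hi h))) && (h \notin Des gamma)].
Proof.
pose R : rel 'I_n := fun i j => (u (sigma i) < u (sigma j))%N ||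
  (u (sigma i) == u (sigma j)) && (gamma i < gamma j)%N.
transitivity [forall h, R (lo h) (hi h)].
  rewrite -forall_pos_lt; last by rewrite /R => i j k; lia.
  apply: eq_forallb => i; apply: eq_forallb => j.
  by rewrite /R !permKV.
by apply: eq_forallb => h; rewrite /R notin_DesE.
Qed.

Lemma enriched_ok_chain u (N : {set 'I_n}) :
  enriched_ok (pos_lt (perm_bij sigma))
    (pos_label (perm_bij gamma) (perm_bij sigma)) N u =
  [forall h : 'I_n.-1, (u (sigma (lo h)) < u (sigma (hi h)))%N ||
     (u (sigma (lo h)) == u (sigma (hi h))) &&
     (if h \in Des gamma then sigma (lo h) \in N else sigma (hi h) \notin N)].
Proof.
pose R : rel 'I_n := fun i j => (u (sigma i) < u (sigma j))%N ||
  (u (sigma i) == u (sigma j)) &&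
     (if sigma i \in N then (sigma j \in N) ==> (gamma j < gamma i)%N
      else (sigma j \notin N) && (gamma i < gamma j)%N).
transitivity [forall h, R (lo h) (hi h)].
  rewrite -forall_pos_lt.
    apply: eq_forallb => i; apply: eq_forallb => j.
    by rewrite /R !permKV.
  move=> i j k; rewrite /R.
  by case: (sigma i \in N); case: (sigma j \in N); case: (sigma k \in N) => /=; lia.
apply: eq_forallb => h; rewrite /R notin_DesE.
have -> : (gamma (hi h) < gamma (lo h))%N = (h \in Des gamma) by rewrite inE.
by case: (h \in Des gamma); case: (_ \in N); case: (_ \in N); rewrite /= ?orbF ?andbT.
Qed.

(* At h with equal values at h and h + 1, a descent forces a negative sign at *)
(* h and an ascent a positive sign at h + 1. Distinct h force distinct        *)
(* positions, except for a conflict at a peak, so 2 ^ #(free positions).      *)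
Lemma sum_enriched_ok u :
  \sum_(N : {set 'I_n}) (enriched_ok (pos_lt (perm_bij sigma))
    (pos_label (perm_bij gamma) (perm_bij sigma)) N u)%:R =
  if [forall h : 'I_n.-1, (u (sigma (lo h)) <= u (sigma (hi h)))%N] &&
     [forall h in Peak gamma, forall k : 'I_n.-1,
        ~~ [&& k.+1 == h :> nat, u (sigma (lo k)) == u (sigma (hi k)) &
            u (sigma (lo h)) == u (sigma (hi h))]]
  then 2 ^+ (n - #|[set h : 'I_n.-1 | u (sigma (lo h)) == u (sigma (hi h))]|)
  else 0 :> rat.
Proof.
set E := [set h : 'I_n.-1 | _].
(* [V] collects the positions forced to be negative, [U] those forced to be positive. Together they
   use #|E| positions when disjoint, which gives the exponent. *)
pose V := [set sigma (lo h) | h in E :&: Des gamma].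
pose U := [set sigma (hi h) | h in E :\: Des gamma].
have lo_inj : injective (fun h : 'I_n.-1 => sigma (lo h)).
  by move=> h k /perm_inj /(congr1 val) /= /val_inj.
have hi_inj : injective (fun h : 'I_n.-1 => sigma (hi h)).
  by move=> h k /perm_inj /(congr1 val) /= [] /val_inj.
case: (boolP [forall h : 'I_n.-1, _]) => [/forallP mono|/forallPn[h nmono]]; last first.
  apply: big1 => N _; rewrite enriched_ok_chain.
  case: (boolP [forall h, _]) => // /forallP/(_ h); lia.
transitivity (\sum_(N in [set N : {set 'I_n} | (V \subset N) && (N \subset ~: U)]) 1 : rat).
  rewrite [RHS]big_mkcond; apply: eq_bigr => N _; rewrite enriched_ok_chain inE.
  rewrite (_ : [forall h, _] = (V \subset N) && (N \subset ~: U)); first by case: ifP.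
  rewrite subsetC; apply/forallP/andP => [H|[/subsetP VN /subsetP UN] h].
    split; apply/subsetP => _ /imsetP[h + ->]; rewrite !inE => /andP[].
      by move=> /eqP hE hD; have := H h; rewrite inE hD hE ltnn eqxx.
    by move=> hD /eqP hE; have := H h; rewrite inE (negPf hD) hE ltnn eqxx.
  have := mono h; rewrite leq_eqVlt orbC => /orP[->//|hE]; rewrite hE /= orbC.
  case: ifPn => hD.
    by rewrite VN //; apply/imsetP; exists h; rewrite // !inE hE; rewrite inE in hD.
  have := UN (sigma (hi h)); rewrite inE => -> //; apply/imsetP; exists h => //.
  by rewrite !inE hE; rewrite inE in hD; rewrite hD.
rewrite sumr_const /=.
have disjE : [forall h in Peak gamma, forall k : 'I_n.-1,
        ~~ [&& k.+1 == h :> nat, u (sigma (lo k)) == u (sigma (hi k)) &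
            u (sigma (lo h)) == u (sigma (hi h))]] = (V \subset ~: U).
  apply/forall_inP/subsetP => [H x /imsetP[h]|H h].
    rewrite !inE => /andP[hE hD ->]; apply/negP => /imsetP[k].
    rewrite !inE => /andP[kD kE] /perm_inj /(congr1 val) /= hk.
    have hP : h \in Peak gamma.
      rewrite inE hD andbT; apply/existsP; exists k.
      have -> : lo h = hi k by apply: val_inj.
      by rewrite hk eqxx notin_DesE inE.
    by have /forallP/(_ k) := H h hP; rewrite hk eqxx kE hE.
  rewrite inE => /andP[/existsP[k0 /andP[/eqP k0h k0lt]] hD].
  apply/forallP => k; apply/negP => /and3P[/eqP kh kE hE].
  have kk : k0 = k by apply: val_inj; apply: succn_inj; rewrite /= k0h kh.
  have lohi : lo h = hi k by apply: val_inj; rewrite /= kh.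
  have /H : sigma (lo h) \in V by apply/imsetP; exists h; rewrite // !inE hE.
  rewrite inE => /negP; apply; apply/imsetP; exists k; last by rewrite lohi.
  by rewrite in_setD -notin_DesE -lohi -kk k0lt inE kk kE.
rewrite disjE; case: ifPn => [VU|nVU].
  rewrite card_between // natrX; congr (_ ^+ _).
  have := cardsC U; have := cardsID (Des gamma) E.
  rewrite card_ord !card_imset // => <- nE.
  by rewrite -[X in _ = (X - _)%N]nE (addnC #|E :&: _|) subnDl.
rewrite eq_card0 // => N; rewrite inE; apply/negP => /andP[VN NU].
by case/negP: nVU; apply: subset_trans VN NU.
Qed.

End Chain.

Section SortPerm.
Variables (n : nat) (e : 'I_n -> nat).

Let key (i : 'I_n) : 'I_n :=
  Ordinal (leq_trans (ltn_lexrank e val i) (eq_leq (card_ord n))).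

Lemma sort_perm_subproof : injective key.
Proof.
move=> i j /(congr1 val) /= /eqP.
by rewrite lexrank_eq => /andP[_ /eqP /val_inj].
Qed.

(** The standardization of [e]: ties are broken from left to right. *)
Definition sort_perm : 'S_n := perm sort_perm_subproof.

Lemma sort_perm_lt i j : (sort_perm i < sort_perm j)%N = lexlt e val i j.
Proof. by rewrite !permE /= lexrank_lt. Qed.

Lemma Des_sort_perm : Des sort_perm = [set h | (e (hi h) < e (lo h))%N].
Proof. by apply/setP => h; rewrite !inE sort_perm_lt /lexlt /=; lia. Qed.

End SortPerm.

Lemma Des_perm_of_Des n (A : {set 'I_n.-1}) : Des (perm_of_Des A) = A.
Proof.
rewrite /perm_of_Des; case: pickP => [s /eqP //|] /=.
(* This weakly decreasing function drops from i to i + 1 exactly when i is in A. *)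
pose e (i : 'I_n) := #|[set a in A | (i <= a)%N]|.
move=> /(_ (sort_perm e)); rewrite Des_sort_perm => /negP[]; apply/eqP/setP => h.
rewrite inE /e; case: (boolP (h \in A)) => hA.
  apply: proper_card; apply/properP; split.
    by apply/subsetP => a; rewrite !inE /= => /andP[-> /ltnW].
  by exists h; rewrite !inE hA //= ltnn.
apply/negbTE; rewrite -leqNgt; apply: subset_leq_card.
apply/subsetP => a; rewrite !inE /= => /andP[aA ha]; rewrite aA ltn_neqAle ha andbT.
by apply: contraNneq hA => /val_inj ->.
Qed.

Lemma Peak_peak_part n (gamma : 'S_n) : Peak gamma = peak_part (Des gamma).
Proof.
apply/setP => i; rewrite /peak_part in_setD in_setU.
rewrite [LHS]inE [in RHS]inE [in RHS]inE negb_or [i \in Des _]inE.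
case: (boolP (gamma (hi i) < gamma (lo i))%N) => _; rewrite ?andbF // !andbT.
apply/existsP/andP => [[h /andP[/eqP hi_ lt]]|[/existsPn nD i0]].
  split; last by rewrite -hi_.
  apply/existsPn => a; rewrite negb_and; case: eqP => ia; rewrite ?orbT // orbF.
  have -> : a = h by apply: val_inj; apply: succn_inj; rewrite /= hi_ ia.
  have E : lo i = hi h by apply: val_inj.
  by rewrite -notin_DesE -E.
have ilt : (i.-1 < n.-1)%N by have := ltn_ord i; lia.
exists (Ordinal ilt); rewrite /= prednK ?lt0n // eqxx /=.
have E : lo i = hi (Ordinal ilt) by apply: val_inj; rewrite /= prednK ?lt0n.
rewrite E notin_DesE; have := nD (Ordinal ilt).
by rewrite negb_and /= prednK ?lt0n // eqxx orbF.
Qed.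

(** The count in [sum_enriched_ok] involves the labelling only through its peaks. *)
Lemma ncK_Peak n (gamma gamma' sigma : 'S_n) : Peak gamma = Peak gamma' ->
  ncK (perm_bij gamma) (perm_bij sigma) = ncK (perm_bij gamma') (perm_bij sigma).
Proof.
move=> PP; apply/funext => w; rewrite !ncK_coef; case: ifP => // _.
by rewrite !sum_enriched_ok PP.
Qed.

Lemma ncK_perm_of_Des n (A : {set 'I_n.-1}) (sigma : 'S_n) :
  ncK (perm_bij (perm_of_Des A)) (perm_bij sigma) =
  ncK (perm_bij (perm_of_Peak (peak_part A))) (perm_bij sigma).
Proof.
apply: ncK_Peak; rewrite Peak_peak_part Des_perm_of_Des /perm_of_Peak.
case: pickP => [s /eqP //|/(_ (perm_of_Des A))] /=.
by rewrite Peak_peak_part Des_perm_of_Des eqxx.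
Qed.

Lemma ncF_chain_coef n (A : {set 'I_n.-1}) (tau : 'S_n) w :
  ncF_chain A tau w =
  ((size w == n) && (0%N \notin w) &&
   [forall h : 'I_n.-1, (nth 0 w (tau (lo h)) < nth 0 w (tau (hi h)))%N ||
     (nth 0 w (tau (lo h)) == nth 0 w (tau (hi h)))%N && (h \notin A)])%:R.
Proof. by rewrite /ncF_chain ncF_coef partition_ok_chain Des_perm_of_Des. Qed.

(** * Order types and the span of the standard F *)

Definition NCQSym_std : set ncseries := fun p =>
  exists n (A : {set 'I_n.-1}) (sigma : 'S_n),
    standard A sigma /\ p = ncF_chain A sigma.

Section StandardSpan.
Variable n : nat.
Implicit Types (u : 'I_n -> nat) (e : {ffun 'I_n -> 'I_n}).

(* Two maps to nat have the same pack iff they have the same order type. *)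
Definition pack u : {ffun 'I_n -> 'I_n} :=
  [ffun i => Ordinal (leq_trans (ltn_lexrank u (fun=> 0%N) i) (eq_leq (card_ord n)))].

Lemma pack_lt u i j : (pack u i < pack u j)%N = (u i < u j)%N.
Proof. by rewrite !ffunE /= lexrank_lt /lexlt; lia. Qed.

Lemma pack_eq u i j : (pack u i == pack u j :> nat) = (u i == u j).
Proof. by rewrite !ffunE /= lexrank_eq; lia. Qed.

Lemma eq_pack u1 u2 : (forall i j, (u1 i < u1 j)%N = (u2 i < u2 j)%N) ->
  pack u1 = pack u2.
Proof.
move=> u12; apply/ffunP => i; rewrite !ffunE; apply: val_inj => /=.
by apply: eq_card => j; rewrite !inE /lexlt u12 !andbF.
Qed.

Lemma packK u : pack (fun i => pack u i) = pack u.
Proof. by apply: eq_pack => i j; rewrite pack_lt. Qed.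

(** The noncommutative monomial series of order type [e]; it vanishes when [e] is not packed. *)
Definition ncM e : ncseries := fun w =>
  ((size w == n) && (0%N \notin w) && (pack (fun i => nth 0%N w i) == e))%:R.

Lemma ncM0 e : pack (fun i => e i) != e -> ncM e = 0.
Proof.
move=> pe; apply/funext => w; rewrite /ncM.
case: (pack _ =P e) => [we|_]; last by rewrite andbF.
by case/eqP: pe; rewrite -we packK.
Qed.

Lemma ncM_expansion (P : ('I_n -> nat) -> bool) (p : ncseries) :
    (forall u, P (fun i => pack u i) = P u) ->
    (forall w, p w = ((size w == n) && (0%N \notin w) && P (fun i => nth 0%N w i))%:R) ->
  p = \sum_(e : {ffun 'I_n -> 'I_n}) (P (fun i => e i))%:R *: ncM e.
Proof.
move=> Ppack pE; apply/funext => w.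
have sumE (s : seq {ffun 'I_n -> 'I_n}) :
    (\sum_(e <- s) (P (fun i => e i))%:R *: ncM e) w =
    \sum_(e <- s) (P (fun i => e i))%:R * ncM e w.
  by elim: s => [|e s IH]; rewrite ?big_nil // !big_cons -IH.
rewrite sumE (bigD1 (pack (fun i => nth 0%N w i))) //= big1 ?addr0.
  by rewrite pE Ppack /ncM eqxx andbT -natrM mulnb andbC.
by move=> e; rewrite eq_sym => /negPf ew; rewrite /ncM ew andbF mulr0.
Qed.

(** The partition condition for the chain that lists positions by [e], ties from left to right,
    strict where [e] increases. *)
Definition compatible (e u : 'I_n -> nat) : bool :=
  [forall i, forall j, lexlt e val i j ==>
     ((u i < u j)%N || (u i == u j) && (e i == e j))].

Lemma compatible_pack (v u : 'I_n -> nat) :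
  compatible v (fun i => pack u i) = compatible v u.
Proof.
apply: eq_forallb => i; apply: eq_forallb => j.
by rewrite pack_lt pack_eq.
Qed.

(** The pair is standard because, in that listing, positions can go down only where [e] goes up. *)
Lemma compatible_std (e : 'I_n -> nat) : exists2 p, NCQSym_std p & forall w,
  p w = ((size w == n) && (0%N \notin w) && compatible e (fun i => nth 0%N w i))%:R.
Proof.
pose tau := (sort_perm e)^-1%g.
pose B := [set h : 'I_n.-1 | (e (tau (lo h)) < e (tau (hi h)))%N].
have tau_lt h : lexlt e val (tau (lo h)) (tau (hi h)).
  by rewrite -sort_perm_lt !permKV /=.
exists (ncF_chain B tau).
  exists n, B, tau; split=> //; apply/subsetP => h; rewrite !inE.
  by have := tau_lt h; rewrite /lexlt /=; lia.
move=> w; rewrite ncF_chain_coef; congr (_%:R); congr nat_of_bool; congr andb.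
pose u (i : 'I_n) := nth 0%N w i.
pose R : rel 'I_n := fun i j => (u (tau i) < u (tau j))%N ||
  (u (tau i) == u (tau j)) && (e (tau i) == e (tau j)).
transitivity [forall h, R (lo h) (hi h)].
  apply: eq_forallb => h; rewrite /R /u inE.
  by have := tau_lt h; rewrite /lexlt; lia.
rewrite -(forall_pos_lt tau); last by rewrite /R => i j k; lia.
apply: eq_forallb => i; apply: eq_forallb => j.
by rewrite /R !permKV /pos_lt /= invgK ltEord sort_perm_lt.
Qed.

(* The standard F of [compatible_std] is the sum of the M_e' with e'          *)
(* compatible with e, and each e' other than e has strictly more strict       *)
(* inequalities.                                                              *)
Lemma ncM_span e : ncM e \in span_pred NCQSym_std.
Proof.
pose str e' := [set ij : 'I_n * 'I_n | (e' ij.1 < e' ij.2)%N].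
have [m] := ubnP #|~: str e|; elim: m => // m IH in e *; rewrite ltnS => em.
have [pe|pe] := eqVneq (pack (fun i => e i)) e; last by rewrite ncM0 // rpred0.
have [p pstd pE] := compatible_std (fun i => e i).
have := ncM_expansion (compatible_pack (fun i => e i)) pE.
rewrite (bigD1 e) //= (_ : compatible _ _ = true) ?scale1r; last first.
  by apply/forallP => i; apply/forallP => j; rewrite /lexlt; lia.
move=> /esym /(canRL (addrK _)) ->.
apply: rpredB; first exact: mem_span.
apply: rpred_sum => e' e'e; case: (boolP (compatible _ _)) => [/forallP ce|_]; last first.
  by rewrite scale0r rpred0.
rewrite scale1r; have [pe'|pe'] := eqVneq (pack (fun i => e' i)) e';
  last by rewrite ncM0 // rpred0.
have se i j : (e i < e j)%N -> (e' i < e' j)%N.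
  by have /forallP/(_ j) := ce i; rewrite /lexlt; lia.
apply: IH; apply: leq_trans em; apply: proper_card; rewrite properC.
apply/properP; split.
  by apply/subsetP => -[i j]; rewrite !inE /=; apply: se.
(* Without a new strict inequality, [e'] and [e] have the same order type and so coincide. *)
have [/existsP[ij /andP[e'ij eij]]|/existsPn str_e'] :=
  boolP [exists ij : 'I_n * 'I_n, (ij \in str e') && (ij \notin str e)].
  by exists ij.
case/eqP: e'e.
rewrite -pe' -pe; apply: eq_pack => i j; apply/idP/idP => [e'ij|]; last exact: se.
by have := str_e' (i, j); rewrite !inE /= e'ij /= negbK.
Qed.

Lemma ncF_span d (X : finPOrderType d) (gamma sigma : bijection X n) :
  ncF gamma sigma \in span_pred NCQSym_std.
Proof.
have Ppack u :
    partition_ok (pos_lt sigma) (pos_label gamma sigma) (fun i => pack u i) =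
    partition_ok (pos_lt sigma) (pos_label gamma sigma) u.
  apply: eq_forallb => i; apply: eq_forallb => j.
  by rewrite pack_lt pack_eq.
rewrite (ncM_expansion Ppack (ncF_coef gamma sigma)).
by apply: rpred_sum => e _; apply: rpredZ; apply: ncM_span.
Qed.

End StandardSpan.

(** * Linear maps between spans *)

Lemma span_pred_eq (U V : lmodType rat) (G : set U) (f g : {linear U -> V}) :
    (forall v, G v -> f v = g v) ->
  forall v, v \in span_pred G -> f v = g v.
Proof.
move=> fg v /asboolP[k [c [s [Gs ->]]]].
by rewrite !linear_sum; apply: eq_bigr => i _; rewrite !linearZ fg.
Qed.

Section SpanMaps.
Variables (U V : lmodType rat) (G : set U) (H : set V) (f : {linear U -> V}).

Lemma span_linear_eq (G' : set U) (T : {linear Defs.span G -> Defs.span H}) :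
    (forall v, G' v -> exists2 p : Defs.span G, val p = v & val (T p) = f v) ->
  forall p : Defs.span G, val p \in span_pred G' -> val (T p) = f (val p).
Proof.
move=> TG p /asboolP[k [c [g [Gg pE]]]].
have /choice[q qE] (i : 'I_k) :
    exists q : Defs.span G, val q = g i /\ val (T q) = f (g i).
  by have [q] := TG _ (Gg i); exists q.
have -> : p = \sum_i c i *: q i.
  apply: val_inj; rewrite pE linear_sum; apply: eq_bigr => i _.
  by rewrite linearZ /= (qE i).1.
rewrite !linear_sum; apply: eq_bigr => i _.
by rewrite !linearZ /= (qE i).2 (qE i).1.
Qed.

Hypothesis GH : forall v, G v -> H (f v).

Lemma span_map_subproof (p : Defs.span G) : f (val p) \in span_pred H.
Proof.
case: p => /= _ /asboolP[k [c [g [Gg ->]]]].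
rewrite linear_sum; apply: rpred_sum => i _; rewrite linearZ.
by apply: rpredZ; apply: mem_span; apply: GH.
Qed.

Definition span_map (p : Defs.span G) : Defs.span H := Span (span_map_subproof p).

Lemma span_map_is_linear : linear span_map.
Proof. by move=> x p q; apply: val_inj; rewrite /= !linearP. Qed.

HB.instance Definition _ :=
  GRing.isLinear.Build rat (Defs.span G) (Defs.span H) _ span_map span_map_is_linear.

Definition span_map_linear : {linear Defs.span G -> Defs.span H} := span_map.

End SpanMaps.

(** * Identification of the two Theta maps *)

Lemma the_linearP (U V : lmodType rat) (P : {linear U -> V} -> Prop) :
  (exists T, P T) -> P (the_linear P).
Proof. by rewrite /the_linear; case: pselect => // exT _; case: cid. Qed.

Lemma Theta_NCQSymP : is_Theta_NCQSym Theta_NCQSym.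
Proof.
apply: the_linearP.
have GH p : NCQSym_gen p -> NCPi_gen (theta p).
  by case=> n [A [sigma ->]]; rewrite theta_ncF; exact: NCPi_genP.
exists (span_map_linear (f := theta) GH) => n A sigma _; apply: val_inj => /=.
by rewrite theta_ncF ncK_perm_of_Des.
Qed.

Lemma NCQSym_std_span (p : NCQSym) : val p \in span_pred NCQSym_std.
Proof.
case: p => /= _ /asboolP[k [c [g [Gg ->]]]].
apply: rpred_sum => i _; apply: rpredZ.
by have [n [A [sigma ->]]] := Gg i; exact: ncF_span.
Qed.

(** Theta is specified on standard pairs only; since these span, it is forced to be [theta]. *)
Lemma val_Theta_NCQSym (p : NCQSym) :
  val (Theta_NCQSym p) = theta (val p).
Proof.
apply: (@span_linear_eq _ _ _ _ theta NCQSym_std); last exact: NCQSym_std_span.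
move=> _ [n [A [sigma [stdA ->]]]]; exists (NCQSymF A sigma) => //.
by rewrite (Theta_NCQSymP stdA) /= theta_ncF ncK_perm_of_Des.
Qed.

Definition sorted_lift (c : cseries) : ncseries :=
  fun w => if sorted leq w then c (seq_mset w) else 0.

Lemma sorted_lift_is_linear : linear sorted_lift.
Proof.
move=> x c1 c2; apply/funext => w.
transitivity (x * sorted_lift c1 w + sorted_lift c2 w) => //.
by rewrite /sorted_lift; case: ifP => _ //; rewrite mulr0 addr0.
Qed.

HB.instance Definition _ :=
  GRing.isLinear.Build rat cseries ncseries _ sorted_lift sorted_lift_is_linear.

(** Partitions of the chain increase weakly, so for sigma = 1 their words are sorted, and a multiset
    has a single sorted word. *)
Lemma sorted_lift_cF n (A : {set 'I_n.-1}) :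
  sorted_lift (cF_chain n A) = ncF_chain A 1%g.
Proof.
apply/funext => w; rewrite /sorted_lift /cF_chain /ncF_chain /cF /ncF /monomial_sum.
have word_sorted (f : {ffun 'I_n -> nat}) : is_partition (perm_bij (perm_of_Des A)) f ->
    sorted leq (word (perm_bij 1%g) f).
  case=> _ fle _; rewrite sorted_map /=.
  apply: (@sub_sorted _ (relpre val leq)).
    by move=> i j; rewrite /= !invg1 !perm1; apply: fle.
  rewrite -sorted_map val_enum_ord; exact: iota_sorted.
case: ifP => sw; last first.
  rewrite fsbig1 // => f /word_sorted; case: eqP => // ->.
  by rewrite sw.
apply: eq_fsbigr => f /set_mem /word_sorted sf; congr (_%:R); congr nat_of_bool.
rewrite -(seq_mset_word (perm_bij 1%g)).
apply/eqP/eqP => [/eq_seq_msetP ww|-> //].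
by apply: (sorted_eq leq_trans anti_leq).
Qed.

Definition cTheta : {linear cseries -> cseries} := rho \o theta \o sorted_lift.

Lemma cTheta_cF n (A : {set 'I_n.-1}) :
  cTheta (cF_chain n A) = cK (perm_bij (perm_of_Peak (peak_part A))).
Proof.
by rewrite /= sorted_lift_cF theta_ncF ncK_perm_of_Des rho_ncK.
Qed.

Lemma Theta_QSymP : is_Theta_QSym Theta_QSym.
Proof.
apply: the_linearP.
have GH p : QSym_gen p -> Pi_gen (cTheta p).
  by case=> n [A ->]; rewrite cTheta_cF; exact: Pi_genP.
exists (span_map_linear (f := cTheta) GH) => n A; apply: val_inj.
exact: cTheta_cF.
Qed.

Lemma val_Theta_QSym (p : QSym) : val (Theta_QSym p) = cTheta (val p).
Proof.
apply: (@span_linear_eq _ _ _ _ cTheta QSym_gen); last by case: p.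
move=> _ [n [A ->]]; exists (QSymF n A) => //.
by rewrite Theta_QSymP cTheta_cF.
Qed.

Theorem theorem9p4 (d : Order.disp_t) (X : finPOrderType d) (n : nat)
    (gamma sigma : bijection X n) :
  [/\ forall (A : {set 'I_n.-1}) (tau : 'S_n),
        Theta_NCQSym (NCQSymF A tau) = NCPiK_chain (peak_part A) tau,
      exists2 p : NCQSym, \val p = ncF gamma sigma
        & Theta_NCQSym p = NCPiK gamma sigma
    & rho_NCPi \o Theta_NCQSym =1 Theta_QSym \o rho_NCQSym].
Proof.
split=> [A tau||p].
- apply: val_inj; rewrite val_Theta_NCQSym /=.
  by rewrite theta_ncF ncK_perm_of_Des.
(* Membership in NCQSym follows from the expansion into standard F. *)
- have FG : ncF gamma sigma \in span_pred NCQSym_gen.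
    have /asboolP[k [c [g [Gg ->]]]] := ncF_span gamma sigma.
    apply: rpred_sum => i _; apply: rpredZ; apply: mem_span.
    by have [m [A [tau [_ ->]]]] := Gg i; exact: NCQSym_genP.
  exists (Span FG) => //; apply: val_inj.
  by rewrite val_Theta_NCQSym /= theta_ncF.
- apply: val_inj; rewrite /= val_Theta_QSym /= val_Theta_NCQSym.
  apply: (@span_pred_eq _ _ NCQSym_gen (rho \o theta) (cTheta \o rho)); last by case: p.
  move=> _ [m [A [tau ->]]] /=.
  by rewrite theta_ncF ncK_perm_of_Des rho_ncK rho_ncF sorted_lift_cF theta_ncF
    ncK_perm_of_Des rho_ncK.
Qed.
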